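(* Let $a<b$ be real numbers, let $m,l,n\in\mathbb{N}$ (positive integers), let $A\in(C^{(n-1)})^{m\times m}$, and let $B\colon(C^{(n)})^{m}\to\mathbb{C}^{l}$ be an arbitrary continuous linear operator. Put $(Ly)(t):=y'(t)+A(t)y(t)$ for $y\in(C^{(n)})^m$, and consider the (Fredholm) operator $$(L,B)\colon (C^{(n)})^m\to (C^{(n-1)})^m\times\mathbb{C}^{l},\qquad y\mapsto(Ly,By).$$ Let $M(L,B)\in\mathbb{C}^{l\times m}$ be its characteristic matrix. Then $$\dim\ker(L,B)=m-\operatorname{rank}M(L,B),\qquad \dim\operatorname{coker}(L,B)=l-\operatorname{rank}M(L,B).$$
   Context: For an integer $n\ge 0$, $C^{(n)}$ denotes the complex Banach space of all $n$ times continuously differentiable functions $x\colon[a,b]\to\mathbb{C}$ with norm $\|x\|_{(n)}=\sum_{j=0}^{n}\max_{a\le t\le b}|x^{(j)}(t)|$; $C^{(0)}=C$ is the space of continuous functions. $(C^{(n)})^m$ and $(C^{(n)})^{m\times m}$ are the complex Banach spaces of $m$-dimensional (column) vector functions and of $m\times m$ matrix functions, respectively, with all components in $C^{(n)}$; the norm of a vector function is the sum of the norms of its components, and the norm of a matrix function is the maximum of the norms of its columns. For a continuous linear operator $T\colon X\to Y$ between Banach spaces, $\operatorname{coker}T:=Y/T(X)$; $T$ is Fredholm if $\ker T$ and $\operatorname{coker}T$ are finite-dimensional. Characteristic matrix: let $Y\in(C^{(n)})^{m\times m}$ be the unique solution of the matrix Cauchy problem $Y'(t)+A(t)Y(t)=O_m$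 for $t\in(a,b)$, $Y(a)=I_m$, where $O_m$ and $I_m$ are the zero and identity $m\times m$ matrices. The characteristic matrix $M(L,B)$ is the $l\times m$ complex matrix whose $j$-th column is the result of applying $B$ to the $j$-th column of $Y$, for $j=1,\dots,m$. *)

(* Defs.v *)
From HB Require Import structures.
From mathcomp Require Import all_boot all_order all_algebra.
From mathcomp Require Import complex.
From mathcomp Require Import all_classical all_reals all_analysis.
From mathcomp Require Import ring lra.
Set Implicit Arguments.
Unset Strict Implicit.
Unset Printing Implicit Defensive.
Import Order.TTheory GRing.Theory Num.Theory numFieldNormedType.Exports.
Local Open Scope classical_set_scope.
Local Open Scope complex_scope.
Local Open Scope quotient_scope.
Local Open Scope ring_scope.

Section ker_coker.
Variables (K : fieldType) (U V : lmodType K) (T : {linear U -> V}).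

Definition ker_pred : {pred U} := [pred u | T u == 0].
Fact ker_submod_closed : submod_closed ker_pred.
Proof.
split=> [|c u v]; first by rewrite inE linear0.
by rewrite !inE linearP => /eqP-> /eqP->; rewrite scaler0 addr0.
Qed.
HB.instance Definition _ :=
  GRing.isSubmodClosed.Build K U ker_pred ker_submod_closed.

Definition ker := {u | u \in ker_pred}.
HB.instance Definition _ := SubChoice.on ker.
HB.instance Definition _ := [SubChoice_isSubLmodule of ker by <:].

Definition im_pred : {pred V} := [pred v | `[< exists u, T u = v >]].
Fact im_submod_closed : submod_closed im_pred.
Proof.
split=> [|c u v]; first by apply/asboolP; exists 0; rewrite linear0.
move=> /asboolP[x <-] /asboolP[y <-]; apply/asboolP.
by exists (c *: x + y); rewrite linearP.
Qed.
HB.instance Definition _ :=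
  GRing.isSubmodClosed.Build K V im_pred im_submod_closed.

(* The quotient space V / T(U). *)
Definition coker := Quotient.quot im_pred.
HB.instance Definition _ := GRing.Zmodule.on coker.
HB.instance Definition _ := Quotient.on coker.

Definition coker_pi (v : V) : coker := \pi_(coker) v.
Definition coker_scale (c : K) (x : coker) : coker := coker_pi (c *: repr x).

Lemma coker_piP u v : reflect (coker_pi u = coker_pi v) (u - v \in im_pred).
Proof. by rewrite Quotient.idealrBE; exact: eqP. Qed.
Lemma coker_piK x : coker_pi (repr x) = x. Proof. exact: reprK. Qed.
Lemma coker_piD u v : coker_pi (u + v) = coker_pi u + coker_pi v.
Proof. exact: Quotient.pi_add. Qed.
Lemma coker_pi_scale c v : coker_pi (c *: v) = coker_scale c (coker_pi v).
Proof.
apply/coker_piP; rewrite -scalerBr rpredZ//; apply/coker_piP.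
by rewrite coker_piK.
Qed.
Fact coker_scaleA c d x : coker_scale c (coker_scale d x) = coker_scale (c * d) x.
Proof. by rewrite -[x]coker_piK -!coker_pi_scale scalerA. Qed.
Fact coker_scale1 : left_id 1 coker_scale.
Proof. by move=> x; rewrite -[x]coker_piK -coker_pi_scale scale1r. Qed.
Fact coker_scaleDr : right_distributive coker_scale +%R.
Proof.
move=> c x y; rewrite -[x]coker_piK -[y]coker_piK -coker_piD -!coker_pi_scale.
by rewrite -coker_piD scalerDr.
Qed.
Fact coker_scaleDl x : {morph coker_scale^~ x : c d / c + d}.
Proof.
by move=> c d; rewrite -[x]coker_piK -!coker_pi_scale -coker_piD scalerDl.
Qed.
HB.instance Definition _ := GRing.Zmodule_isLmodule.Build K coker
  coker_scaleA coker_scale1 coker_scaleDr coker_scaleDl.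
End ker_coker.

(* E has finite dimension d, i.e. it has a basis with d elements. *)
Definition has_dim (K : fieldType) (E : lmodType K) (d : nat) : Prop :=
  exists e : 'I_d -> E,
    (forall c : 'I_d -> K, \sum_(i < d) c i *: e i = 0 -> forall i, c i = 0) /\
    (forall v, exists c : 'I_d -> K, v = \sum_(i < d) c i *: e i).

(* R[i] with the topology and the norm given by the modulus. *)
HB.instance Definition _ (R : realType) := NormedModule.copy R[i] R[i]^o.

Section normc_facts.
Variable R : realType.
Implicit Types z : R[i].

Lemma normCE z : `|z| = (Normc.normc z)%:C.
Proof. by []. Qed.

Lemma normc_ge0 z : 0 <= Normc.normc z.
Proof. by rewrite -lecR -normCE normr_ge0. Qed.

Lemma normcD z1 z2 : Normc.normc (z1 + z2) <= Normc.normc z1 + Normc.normc z2.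
Proof. by rewrite -lecR rmorphD /= -!normCE ler_normD. Qed.

Lemma normc_real (x : R) : Normc.normc x%:C = `|x|.
Proof. by rewrite /Normc.normc /= expr0n addr0 sqrtr_sqr. Qed.

Lemma cvg_realC (T : Type) (F : set_system T) {FF : Filter F} (f : T -> R) (l : R) :
  f @ F --> l -> ((f t)%:C @[t --> F]) --> l%:C.
Proof.
move=> /cvgrPdist_lt fl; apply/cvgrPdist_lt => e e0.
have eE : e = (complex.Re e)%:C by rewrite RRe_real// gtr0_real.
have e0' : 0 < complex.Re e by rewrite -ltcR -eE.
near=> t; rewrite -rmorphB normCE normc_real eE ltcR.
near: t; exact: fl.
Unshelve. all: by end_near. Qed.

Lemma cvg_normc (T : Type) (F : set_system T) {FF : Filter F} (f : T -> R[i]) (l : R[i]) :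
  f @ F --> l -> (Normc.normc (f t) @[t --> F]) --> Normc.normc l.
Proof.
move=> /cvgrPdist_lt fl; apply/cvgrPdist_lt => e e0.
have : \forall t \near F, `|l - f t| < e%:C by apply: fl; rewrite ltcR.
apply: filterS => t; rewrite normCE ltcR; apply: le_lt_trans.
rewrite ler_norml; apply/andP; split.
  have := normcD (f t - l) l; rewrite subrK.
  have -> : Normc.normc (f t - l) = Normc.normc (l - f t).
    by apply: complexI; rewrite -!normCE distrC.
  by rewrite lerNl opprB lerBlDr.
by rewrite lerBlDr; have := normcD (l - f t) (f t); rewrite subrK.
Qed.

End normc_facts.

(* The interval [a, b] as a type: functions on it are determined by their
   values on [a, b], so that spaces of functions have the right dimension. *)
Definition seg (R : realType) (a b : R) (ab : a < b) : Type :=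
  set_type `[a, b]%classic.

HB.instance Definition _ (R : realType) (a b : R) (ab : a < b) :=
  PseudoMetric.copy (seg ab) (set_type `[a, b]%classic).

Definition segval (R : realType) (a b : R) (ab : a < b) (t : seg ab) : R :=
  \val t.
Coercion segval : seg >-> Real.sort.

Section derivative.
Variables (R : realType) (a b : R) (ab : a < b).
Implicit Types (f g : seg ab -> R[i]) (t : seg ab).

Lemma segP t : a <= (t : R) <= b.
Proof. by have := set_valP t; rewrite /= in_itv. Qed.

Lemma seg_inj : injective (@segval R a b ab).
Proof. exact: val_inj. Qed.

Definition mkseg (x : R) (xab : a <= x <= b) : seg ab :=
  exist _ x (mem_set xab).

Lemma segvalK x (xab : a <= x <= b) : mkseg xab = x :> R.
Proof. by []. Qed.

Lemma seg_ballE t e (s : seg ab) : ball t e s = (`|(t : R) - (s : R)| < e).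
Proof. by []. Qed.

Global Instance seg_dnbhs_proper t : ProperFilter t^'.
Proof.
apply: Build_ProperFilter_ex => A /nbhs_ballP[e /= e0 Ae].
have /andP[at_ tb] := segP t.
pose d := Num.min e ((b - a) / 2) / 2.
have d0 : 0 < d by rewrite divr_gt0// lt_min e0 divr_gt0// subr_gt0.
have [de dab] : d < e /\ d < (b - a) / 2.
  apply/andP; rewrite -lt_min /d gtr_pMr; first by rewrite invf_lt1// ltr1n.
  by rewrite lt_min e0 divr_gt0// subr_gt0.
have [h|h] := leP (t : R) ((a + b) / 2).
- have sP : a <= (t : R) + d <= b by apply/andP; split; lra.
  exists (mkseg sP); apply: Ae.
    by rewrite seg_ballE segvalK opprD addNKr normrN gtr0_norm.
  apply/eqP => /(congr1 (@segval R a b ab)); rewrite segvalK; lra.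
- have sP : a <= (t : R) - d <= b by apply/andP; split; lra.
  exists (mkseg sP); apply: Ae.
    by rewrite seg_ballE segvalK opprB addrC subrK gtr0_norm.
  apply/eqP => /(congr1 (@segval R a b ab)); rewrite segvalK; lra.
Qed.

Definition dquot f t (s : seg ab) : R[i] := (f s - f t) / ((s : R) - (t : R))%:C.

(* The limit is taken inside [a, b]: it is one-sided at the end points. *)
Definition deriv f t : R[i] := lim (dquot f t s @[s --> t^']).

Fixpoint Cn (n : nat) f : Prop :=
  if n is k.+1 then (forall t, cvg (dquot f t s @[s --> t^'])) /\ Cn k (deriv f)
  else continuous f.

Lemma deriv_unique f t l : dquot f t s @[s --> t^'] --> l -> deriv f t = l.
Proof. by move=> fl; apply/cvg_lim => //; exact: norm_hausdorff. Qed.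

Definition has_deriv f g := forall t, dquot f t s @[s --> t^'] --> g t.

Lemma has_derivE f g : has_deriv f g -> deriv f = g.
Proof. by move=> fg; apply/funext => t; exact: deriv_unique. Qed.

Lemma CnSP k f : Cn k.+1 f <-> exists g, has_deriv f g /\ Cn k g.
Proof.
split=> [[df cf]|[g [fg cg]]]; first by exists (deriv f); split=> // t; exact: df.
by split; [move=> t; apply/cvg_ex; exists (g t)|rewrite (has_derivE fg)].
Qed.

Lemma near_cvg (T : Type) (F : set_system T) {FF : Filter F} (f g : T -> R[i])
    (l : R[i]) :
  g @ F --> l -> {near F, f =1 g} -> f @ F --> l.
Proof. by move=> gl fg; apply: cvg_trans gl; apply: near_eq_cvg; apply: filterS fg. Qed.

Lemma has_deriv_continuous f g : has_deriv f g -> continuous f.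
Proof.
move=> fg t; apply/continuous_withinNx.
have vt : ((segval s) - (segval t))%:C @[s --> t^'] --> (0 : R)%:C.
  apply: cvg_realC; apply/cvgrPdist_lt => e e0; rewrite near_withinE.
  near=> s => _; rewrite sub0r normrN distrC.
  by near: s; apply/nbhs_ballP; exists e => // s; rewrite seg_ballE.
pose proof (cvgD (cvgM (fg t) vt) (cvg_cst (f t))) as H; rewrite mulr0 add0r in H.
apply: (near_cvg H); near=> s.
have st : s != t by near: s; exact: nbhs_dnbhs_neq.
transitivity (dquot f t s * (segval s - segval t)%:C + f t); last by [].
rewrite /dquot divfK ?subrK//.
rewrite -(rmorph0 (@real_complex R)) (inj_eq (@complexI R)) subr_eq0.
by apply: contra st => /eqP/seg_inj ->.
Unshelve. all: by end_near. Qed.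

Lemma has_deriv_lin f1 g1 f2 g2 c : has_deriv f1 g1 -> has_deriv f2 g2 ->
  has_deriv (c *: f1 + f2) (c *: g1 + g2).
Proof.
move=> h1 h2 t.
have H : c * dquot f1 t s + dquot f2 t s @[s --> t^'] --> c * g1 t + g2 t.
  by apply: cvgD (h2 t); apply: cvgM (h1 t); exact: cvg_cst.
apply: (near_cvg H); near=> s.
rewrite /dquot !fctE /GRing.scale /=; ring.
Unshelve. all: by end_near. Qed.

Lemma has_derivM f1 g1 f2 g2 : has_deriv f1 g1 -> has_deriv f2 g2 ->
  has_deriv (f1 * f2) (g1 * f2 + f1 * g2).
Proof.
move=> h1 h2 t.
have c2 : f2 s @[s --> t^'] --> f2 t.
  by apply/continuous_withinNx; exact: has_deriv_continuous h2 _.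
have H : dquot f1 t s * f2 s + f1 t * dquot f2 t s @[s --> t^']
    --> g1 t * f2 t + f1 t * g2 t.
  by apply: cvgD; [exact: cvgM (h1 t) c2|apply: cvgM (h2 t); exact: cvg_cst].
apply: (near_cvg H); near=> s.
rewrite /dquot !fctE /=; ring.
Unshelve. all: by end_near. Qed.

Lemma has_deriv_cst c : has_deriv (cst c) 0.
Proof.
move=> t; pose proof (cvg_cst (0 : R[i]) (F := t^')) as H.
by apply: (near_cvg H); near=> s; rewrite /dquot subrr mul0r.
Unshelve. all: by end_near. Qed.

Lemma CnS n f : Cn n.+1 f -> Cn n f.
Proof.
elim: n f => [|n IH] f; first by move=> /CnSP[g [fg _]]; exact: has_deriv_continuous fg.
by move=> /CnSP[g [fg /IH cg]]; apply/CnSP; exists g.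
Qed.

Lemma Cn_lin n f g c : Cn n f -> Cn n g -> Cn n (c *: f + g).
Proof.
elim: n f g => [|n IH] f g.
  move=> cf cg t.
  have H : c * f s + g s @[s --> t] --> c * f t + g t.
    by apply: cvgD (cg t); apply: cvgM (cf t); exact: cvg_cst.
  exact: H.
move=> /CnSP[f' [hf cf]] /CnSP[g' [hg cg]]; apply/CnSP.
by exists (c *: f' + g'); split; [exact: has_deriv_lin|exact: IH].
Qed.

Lemma Cn_cst n c : Cn n (cst c).
Proof.
elim: n c => [|n IH] c; first exact: cst_continuous.
by apply/CnSP; exists 0; split; [exact: has_deriv_cst|exact: (IH 0)].
Qed.

Lemma CnD n f g : Cn n f -> Cn n g -> Cn n (f + g).
Proof. by move=> cf cg; rewrite -[f]scale1r; exact: Cn_lin. Qed.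

Lemma CnM n f g : Cn n f -> Cn n g -> Cn n (f * g).
Proof.
elim: n f g => [|n IH] f g.
  by move=> cf cg t; exact: cvgM (cf t) (cg t).
move=> cf cg; have [/CnS cf' /CnS cg'] := (cf, cg).
move: cf cg => /CnSP[f' [hf kf]] /CnSP[g' [hg kg]]; apply/CnSP.
exists (f' * g + f * g'); split; first exact: has_derivM.
by apply: CnD; exact: IH.
Qed.

Lemma CnZ n c f : Cn n f -> Cn n (c *: f).
Proof. by move=> cf; rewrite -[c *: f]addr0; apply: Cn_lin => //; exact: Cn_cst. Qed.

Lemma Cn_sum n (I : Type) (r : seq I) (F : I -> seg ab -> R[i]) :
  (forall i, Cn n (F i)) -> Cn n (\sum_(i <- r) F i).
Proof.
move=> cF; elim/big_ind: _ => //; [exact: Cn_cst|by move=> *; exact: CnD].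
Qed.

Lemma Cn_deriv n f : Cn n.+1 f -> Cn n (deriv f).
Proof. by case. Qed.

Lemma deriv_lin n f g c : Cn n.+1 f -> Cn n.+1 g ->
  deriv (c *: f + g) = c *: deriv f + deriv g.
Proof.
by move=> [df _] [dg _]; apply/has_derivE/has_deriv_lin => t;
  [exact: df|exact: dg].
Qed.

Lemma Cn_iter n j f : (j <= n)%N -> Cn n f -> Cn (n - j) (iter j deriv f).
Proof.
elim: j => [|j IH] jn cf /=; first by rewrite subn0.
by apply: Cn_deriv; rewrite -subSn// subSS; exact: IH (ltnW jn) cf.
Qed.

Lemma Cn_continuous n f : Cn n f -> continuous f.
Proof. by case: n => [//|n] /CnSP[g [fg _]]; exact: has_deriv_continuous fg. Qed.

Lemma iter_deriv_lin n j f g c : (j <= n)%N -> Cn n f -> Cn n g ->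
  iter j deriv (c *: f + g) = c *: iter j deriv f + iter j deriv g.
Proof.
elim: j => [//|j IH] jn cf cg /=; rewrite IH ?(ltnW jn)//.
by apply: (@deriv_lin (n - j.+1)); rewrite -subSn// subSS;
  apply: Cn_iter => //; exact: ltnW.
Qed.

(* For a continuous f this supremum is attained, see continuous_has_sup and the
   extreme value theorem used there. *)
Definition supnorm f : R := sup (range (fun t => Normc.normc (f t))).

Definition Cnorm (n : nat) f : R := \sum_(j < n.+1) supnorm (iter j deriv f).

Let t0 : seg ab := mkseg (introT andP (conj (lexx a) (ltW ab))).

Lemma continuous_has_sup f : continuous f ->
  has_sup (range (fun t => Normc.normc (f t))).
Proof.
move=> cf; split; first by exists (Normc.normc (f t0)), t0.
have cn : continuous (fun t => Normc.normc (f t)) by move=> t; exact: (cvg_normc (cf t)).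
have := (@subspace_valL_continuousP _ `[a, b]%classic R _).2 cn.
move=> /(EVT_max (ltW ab))[c _ hc].
set h := valL_ point _ in hc.
have hE (t : seg ab) : h (segval t) = Normc.normc (f t).
  exact: (congr1 (fun k => k t)
    (@valLK _ _ point `[a, b]%classic (fun t => Normc.normc (f t)))).
exists (h c) => _ [t _ <-] /=; rewrite -hE.
by apply: hc; rewrite in_itv/= segP.
Qed.

Lemma supnorm_ge f t : continuous f -> Normc.normc (f t) <= supnorm f.
Proof. by move=> /continuous_has_sup/sup_upper_bound; apply; exists t. Qed.

Lemma supnorm_le f M : (forall t, Normc.normc (f t) <= M) -> supnorm f <= M.
Proof.
by move=> fM; apply: ge_sup; [exists (Normc.normc (f t0)), t0|move=> _ [t _ <-]].
Qed.

Lemma supnorm_ge0 f : continuous f -> 0 <= supnorm f.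
Proof. by move=> /(@supnorm_ge f t0); apply: le_trans; exact: normc_ge0. Qed.

Lemma supnormD f g : continuous f -> continuous g ->
  supnorm (f + g) <= supnorm f + supnorm g.
Proof.
move=> cf cg; apply: supnorm_le => t; apply: le_trans (normcD _ _) _.
by apply: lerD; exact: supnorm_ge.
Qed.

Lemma supnormZ f c : continuous f ->
  supnorm (c *: f) = Normc.normc c * supnorm f.
Proof.
move=> cf; have le_Z k h : continuous h ->
    supnorm (k *: h) <= Normc.normc k * supnorm h.
  move=> ch; apply: supnorm_le => t; rewrite Normc.normcM.
  by rewrite ler_wpM2l ?normc_ge0// supnorm_ge.
apply/eqP; rewrite eq_le le_Z//=; have [->|c0] := eqVneq c 0.
  have z := @CnZ 0 0 f cf.
  by rewrite Normc.normc0 mul0r; exact: supnorm_ge0 z.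
have nc0 : 0 < Normc.normc c.
  by rewrite lt_def normc_ge0 andbT; apply: contra_neq c0; exact: Normc.eq0_normc.
rewrite -ler_pdivlMl// -Normc.normcV -{1}[f](scalerK c0).
by apply: le_Z; exact: (@CnZ 0 c f cf).
Qed.

Lemma Cn_iter_continuous n (j : 'I_n.+1) f : Cn n f -> continuous (iter j deriv f).
Proof.
by move=> cf; apply: (@Cn_continuous (n - j)); apply: Cn_iter => //; rewrite -ltnS.
Qed.

Lemma Cnorm_ge0 n f : Cn n f -> 0 <= Cnorm n f.
Proof.
by move=> cf; apply: sumr_ge0 => j _; exact: supnorm_ge0 (@Cn_iter_continuous n j f cf).
Qed.

Lemma CnormD n f g : Cn n f -> Cn n g -> Cnorm n (f + g) <= Cnorm n f + Cnorm n g.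
Proof.
move=> cf cg; rewrite /Cnorm -big_split /=; apply: ler_sum => j _.
rewrite -[f]scale1r (@iter_deriv_lin n) ?scale1r//; last by rewrite -ltnS.
by apply: supnormD; exact: Cn_iter_continuous.
Qed.

Lemma CnormZ n f c : Cn n f -> Cnorm n (c *: f) = Normc.normc c * Cnorm n f.
Proof.
move=> cf; rewrite /Cnorm mulr_sumr; apply: eq_bigr => j _.
have jn : (j <= n)%N by rewrite -ltnS.
have z0 : iter j deriv (0 : seg ab -> R[i]) = 0.
  elim: (j : nat) => [//|k /= ->]; exact: (has_derivE (has_deriv_cst 0)).
rewrite -[c *: f]addr0 (iter_deriv_lin c jn cf (Cn_cst n 0)) z0 addr0.
exact: supnormZ c (@Cn_iter_continuous n j f cf).
Qed.

Lemma Cnorm_eq0 n f : Cn n f -> Cnorm n f = 0 -> f = 0.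
Proof.
move=> cf; rewrite /Cnorm big_ord_recl => /eqP; rewrite paddr_eq0; first last.
- by apply: sumr_ge0 => j _; exact: supnorm_ge0 (@Cn_iter_continuous n (lift ord0 j) f cf).
- exact: supnorm_ge0 (@Cn_iter_continuous n ord0 f cf).
move=> /andP[/eqP f0 _]; apply/funext => t; apply: Normc.eq0_normc.
apply/eqP; rewrite eq_le normc_ge0 andbT -f0.
exact: supnorm_ge (Cn_continuous cf).
Qed.

End derivative.

Section Cspace.
Variables (R : realType) (a b : R) (ab : a < b) (n p q : nat).

Definition entry (F : seg ab -> 'M[R[i]]_(p, q)) i j : seg ab -> R[i] :=
  fun t => F t i j.

(* All components are n times continuously differentiable. *)
Definition Cn_pred : {pred seg ab -> 'M[R[i]]_(p, q)} :=
  [pred F | `[< forall i j, Cn n (entry F i j) >]].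

Lemma entry_lin c F G i j :
  entry (c *: F + G) i j = c *: entry F i j + entry G i j.
Proof. by apply/funext => t; rewrite /entry !fctE !mxE. Qed.

Fact Cn_submod_closed : submod_closed Cn_pred.
Proof.
split=> [|c F G /asboolP cF /asboolP cG]; apply/asboolP => i j.
  have -> : entry 0 i j = cst 0 by apply/funext => t; rewrite /entry mxE.
  exact: Cn_cst.
by rewrite entry_lin; exact: Cn_lin.
Qed.
HB.instance Definition _ :=
  GRing.isSubmodClosed.Build R[i] _ Cn_pred Cn_submod_closed.

(* The space (C^(n))^{p x q}; vector functions are the case q = 1. *)
Definition Cspace := {F | F \in Cn_pred}.
HB.instance Definition _ := SubChoice.on Cspace.
HB.instance Definition _ := [SubChoice_isSubLmodule of Cspace by <:].

Definition Cfun (F : Cspace) : seg ab -> 'M[R[i]]_(p, q) := \val F.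

Lemma Cspace_entry (F : Cspace) i j : Cn n (entry (Cfun F) i j).
Proof. by have /asboolP := valP F; apply. Qed.

Lemma CfunD F G : Cfun (F + G) = Cfun F + Cfun G. Proof. exact: raddfD. Qed.
Lemma CfunZ c F : Cfun (c *: F) = c *: Cfun F. Proof. exact: linearZ. Qed.

Lemma CfunP (F G : Cspace) :
  (forall t i j, Cfun F t i j = Cfun G t i j) -> F = G.
Proof.
by move=> FG; apply/val_inj/funext => t; apply/matrixP => i j; exact: FG.
Qed.

(* Maximum over the columns of the sum of the norms of the components; for q = 1
   it is the sum of the norms of the components. *)
Definition mknorm (F : Cspace) : R :=
  \big[Num.max/0]_(j < q) \sum_(i < p) Cnorm n (entry (Cfun F) i j).

Let colsum F (j : 'I_q) := \sum_(i < p) Cnorm n (entry (Cfun F) i j).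

Let colsum_ge0 F j : 0 <= colsum F j.
Proof. by apply: sumr_ge0 => i _; exact/Cnorm_ge0/Cspace_entry. Qed.

Lemma mknormD F G : mknorm (F + G) <= mknorm F + mknorm G.
Proof.
have nn H : 0 <= mknorm H by apply/bigmax_geP; left.
apply/bigmax_leP; split=> [|j _]; first by rewrite addr_ge0.
apply: (@le_trans _ _ (colsum F j + colsum G j)); last first.
  by apply: lerD; apply: (@le_bigmax_cond _ R _ 0 j xpredT).
rewrite /colsum -big_split; apply: ler_sum => i _ /=.
rewrite -[F]scale1r CfunD CfunZ entry_lin !scale1r.
by apply: CnormD; exact: Cspace_entry.
Qed.

Lemma mknormZ c F : mknorm (c *: F) = Normc.normc c * mknorm F.
Proof.
have E H : mknorm H = \big[Num.max/0]_(j < q) colsum H j by [].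
rewrite !E (big_morph (fun x => Normc.normc c * x) (id1 := 0) (op1 := Num.max)).
- apply: eq_bigr => j _; rewrite /colsum mulr_sumr; apply: eq_bigr => i _.
  rewrite -CnormZ; last exact: Cspace_entry.
  by congr (Cnorm n _); apply/funext => t; rewrite /entry CfunZ !fctE mxE.
- by move=> x y; rewrite maxr_pMr// normc_ge0.
- by rewrite mulr0.
Qed.

Lemma mknorm_eq0 F : mknorm F = 0 -> F = 0.
Proof.
move=> F0; apply: CfunP => t i j.
have : colsum F j == 0.
  rewrite eq_le colsum_ge0 andbT -F0.
  exact: (@le_bigmax_cond _ R _ 0 j xpredT).
rewrite psumr_eq0 => [/allP/(_ i)|k _]; last exact/Cnorm_ge0/Cspace_entry.
rewrite mem_index_enum => /(_ isT)/eqP/(Cnorm_eq0 (Cspace_entry _ _ _)).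
by move=> /(congr1 (fun f => f t)); rewrite /entry => ->; rewrite mxE.
Qed.

(* Norms over the field R[i] take their values in R[i]. *)
Definition mkCnorm (F : Cspace) : R[i] := (mknorm F)%:C.

Fact mkCnormD F G : mkCnorm (F + G) <= mkCnorm F + mkCnorm G.
Proof. by rewrite -rmorphD lecR mknormD. Qed.

Fact mkCnormZ c F : mkCnorm (c *: F) = `|c| * mkCnorm F.
Proof. by rewrite normCE -rmorphM -mknormZ. Qed.

Fact mkCnorm_eq0 F : mkCnorm F = 0 -> F = 0.
Proof. by move=> /complexI/mknorm_eq0. Qed.

HB.instance Definition _ := Lmodule_isNormed.Build R[i] Cspace
  mkCnormD mkCnormZ mkCnorm_eq0.

Lemma Cspace_normE (F : Cspace) :
  `|F| = (\big[Num.max/0]_(j < q) \sum_(i < p) Cnorm n (entry (Cfun F) i j))%:C.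
Proof. by []. Qed.

End Cspace.
Arguments Cspace {R a b} ab n p q.
Coercion Cfun : Cspace >-> Funclass.

Definition Ccol (R : realType) (a b : R) (ab : a < b) (n p q : nat)
    (F : Cspace ab n p q) (j : 'I_q) : Cspace ab n p 1.
Proof.
exists (fun t => col j (F t)); apply/asboolP => i k.
suff -> : entry (fun t => col j (F t)) i k = entry F i j by exact: Cspace_entry.
by apply/funext => t; rewrite /entry mxE.
Defined.

Section operator.
Variables (R : realType) (a b : R) (ab : a < b) (n m : nat).

Definition derivmx p q (F : seg ab -> 'M[R[i]]_(p, q)) (t : seg ab) :=
  \matrix_(i, j) deriv (entry F i j) t.

Lemma derivmx_lin p q c (F G : Cspace ab n.+1 p q) t :
  derivmx (Cfun (c *: F + G)) t = c *: derivmx F t + derivmx G t.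
Proof.
apply/matrixP => i j; rewrite CfunD CfunZ !mxE entry_lin.
by rewrite (@deriv_lin _ _ _ _ n)//; exact: Cspace_entry.
Qed.

(* Since L lowers the order of differentiability by one, the domain is C^(n+1)
   and A is of class C^(n). *)
Variable A : Cspace ab n m m.

Definition opL_fun (y : Cspace ab n.+1 m 1) (t : seg ab) : 'cV[R[i]]_m :=
  derivmx y t + A t *m y t.

Fact opL_subproof y : opL_fun y \in @Cn_pred R a b ab n m 1.
Proof.
apply/asboolP => i j.
have -> : entry (opL_fun y) i j = deriv (entry y i j)
    + \sum_(k <- enum 'I_m) entry A i k * entry y k j.
  apply/funext => t; rewrite /entry /opL_fun !mxE fctE; congr (_ + _).
  by rewrite fct_sumE big_enum.
apply: CnD; first exact: Cn_deriv (Cspace_entry y i j).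
apply: Cn_sum => k; apply: CnM; first exact: Cspace_entry.
exact: CnS (Cspace_entry y k j).
Qed.

Definition opL y : Cspace ab n m 1 := exist _ (opL_fun y) (opL_subproof y).

Variables (l : nat) (B : {linear Cspace ab n.+1 m 1 -> 'cV[R[i]]_l}).

Definition opLB (y : Cspace ab n.+1 m 1) : Cspace ab n m 1 * 'cV[R[i]]_l :=
  (opL y, B y).

Fact opL_linear : linear opL.
Proof.
move=> c y z; apply/val_inj/funext => t.
rewrite [LHS]/= /opL_fun derivmx_lin CfunD CfunZ /= fctE mulmxDr -scalemxAr.
by rewrite [RHS]/(c *: opL_fun y t + opL_fun z t) scalerDr addrACA.
Qed.
HB.instance Definition _ :=
  GRing.isLinear.Build R[i] _ _ _ opL opL_linear.

Fact opLB_linear : linear opLB.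
Proof. by move=> c y z; rewrite /opLB !linearP. Qed.
HB.instance Definition _ :=
  GRing.isLinear.Build R[i] _ _ _ opLB opLB_linear.

Definition matrix_cauchy (Y : Cspace ab n.+1 m m) : Prop :=
  (forall t : seg ab, a < (t : R) < b -> derivmx Y t + A t *m Y t = 0) /\
  (forall t : seg ab, (t : R) = a -> Y t = 1%:M).

Definition charmx (Y : Cspace ab n.+1 m m) : 'M[R[i]]_(l, m) :=
  \matrix_(i < l, j < m) B (Ccol Y j) i 0.
End operator.

(* Main.v *)
Require Import Defs.
From HB Require Import structures.
From mathcomp Require Import all_boot all_order all_algebra.
From mathcomp Require Import perm complex.
From mathcomp Require Import all_classical all_reals all_analysis.
From mathcomp Require Import ring lra.

(** Uniqueness for [y' + A y = 0], obtained from Gronwall's inequality for the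
energy [\sum_i |y_i|^2] integrated in both directions, shows that [Y t] is
invertible for every [t] and that [c |-> Y c] is an isomorphism of [C^m] onto
[ker L].  Variation of constants makes [L] surjective.  As [B (Y c) = M c], the
kernel of [(L, B)] is that of [M], and [(f, v) |-> v - B y], for any [y] with
[L y = f], identifies the cokernel of [(L, B)] with that of [M]. *)

Set Implicit Arguments.
Unset Strict Implicit.
Unset Printing Implicit Defensive.
Import Order.TTheory GRing.Theory Num.Theory numFieldNormedType.Exports.
Local Open Scope classical_set_scope.
Local Open Scope complex_scope.
Local Open Scope ring_scope.

(* [poly.deriv] shadows the derivative of Defs. *)
Local Notation deriv := Defs.deriv.

(** * Linear algebra of a pair [(L, B)] whose first component is parametrised on its kernel by
    [Phi] *)

Section bordered_operator.
Variables (K : fieldType) (U V : lmodType K) (m l : nat).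
Variables (L : {linear U -> V}) (B : {linear U -> 'cV[K]_l}).
Variables (T : {linear U -> (V * 'cV[K]_l)%type}) (Phi : {linear 'cV[K]_m -> U}).
Variable M : 'M[K]_(l, m).
Hypothesis TE : forall u, T u = (L u, B u).
Hypothesis Phi_inj : forall c, Phi c = 0 -> c = 0.
Hypothesis L_Phi : forall c, L (Phi c) = 0.
Hypothesis ker_L : forall u, L u = 0 -> exists c, u = Phi c.
Hypothesis B_Phi : forall c, B (Phi c) = M *m c.

(** Since [T (Phi c) = (0, M *m c)], [Phi] restricts to an isomorphism of the null space of [M] onto
    [ker T]. Matrix kernels consist of rows, so the null space of [M] appears transposed, as
    [kermx M^T]. *)
Lemma has_dim_ker_bordered : has_dim (ker T) (m - \rank M)%N.
Proof.
rewrite -mxrank_tr -mxrank_ker.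
set N := row_base (kermx M^T).
have MN (w : 'rV_(\rank (kermx M^T))) : M *m (w *m N)^T = 0.
  apply: trmx_inj; rewrite trmx_mul trmxK trmx0; apply/sub_kermxP.
  by rewrite (submx_trans (submxMl _ _))// eq_row_base.
pose e0 (w : 'rV_(\rank (kermx M^T))) := Phi (w *m N)^T.
have e0P w : e0 w \in ker_pred T.
  by rewrite inE TE L_Phi B_Phi MN.
pose e i : ker T := exist _ (e0 (delta_mx 0 i)) (e0P _).
have eE c : val (\sum_i c i *: e i) = e0 (\row_i c i).
  rewrite raddf_sum /e0 [\row_i c i]row_sum_delta mulmx_suml.
  rewrite !raddf_sum; apply: eq_bigr => i _ /=.
  by rewrite mxE -scalemxAl !linearZ.
exists e; split=> [c /(congr1 val)|v].
  rewrite eE => /Phi_inj/(congr1 trmx); rewrite trmxK trmx0.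
  have /row_freeP[N' NN'] : row_free N by exact: row_base_free.
  move=> /(congr1 (mulmx^~ N')); rewrite -mulmxA NN' mulmx1 mul0mx => c0 i.
  by have := congr1 (fun w : 'rV_ _ => w 0 i) c0; rewrite !mxE.
have := valP v; rewrite inE TE => /eqP[/ker_L[d vE] Bv].
have : (d^T <= N)%MS.
  rewrite eq_row_base; apply/sub_kermxP; rewrite -trmx_mul -B_Phi -vE.
  by apply/trmx_inj; rewrite trmxK trmx0 Bv.
move=> /submxP[w dw]; exists (fun i => w 0 i); apply: val_inj; rewrite eE /= vE /e0.
rewrite -[d]trmxK dw; congr (Phi (_ *m _)^T); apply/rowP => i; by rewrite mxE.
Qed.

Hypothesis L_surj : forall v, exists u, L u = v.

(* The classes of [(0, w)], with [w] in a complement of the column space of [M],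
   exhaust the cokernel: surjectivity of [L] removes the first component. *)
Lemma has_dim_coker_bordered : has_dim (coker T) (l - \rank M)%N.
Proof.
rewrite -mxrank_tr -mxrank_compl.
set N := row_base (M^T)^C%MS.
pose e0 (w : 'rV_(\rank (M^T)^C)) : (V * 'cV[K]_l)%type := (0, (w *m N)^T).
pose e i : coker T := coker_pi T (e0 (delta_mx 0 i)).
have piZ c v : coker_pi T (c *: v) = c *: coker_pi T v by exact: coker_pi_scale.
have pi0 : coker_pi T 0 = 0.
  by apply: (addrI (coker_pi T 0)); rewrite -coker_piD !addr0.
have eE c : \sum_i c i *: e i = coker_pi T (e0 (\row_i c i)).
  have -> : e0 (\row_i c i) = \sum_i c i *: e0 (delta_mx 0 i).
    apply: injective_projections.
      by rewrite /= raddf_sum big1 // => i _ /=; rewrite scaler0.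
    rewrite /= [\row_i c i]row_sum_delta mulmx_suml !raddf_sum.
    by apply: eq_bigr => i _ /=; rewrite mxE -scalemxAl linearZ.
  rewrite (big_morph _ (@coker_piD _ _ _ T) pi0).
  by apply: eq_bigr => i _; rewrite piZ.
exists e; split=> [c|x].
  rewrite eE -pi0 => /coker_piP; rewrite subr0.
  move=> /asboolP[u]; rewrite TE => -[/ker_L[d ->]]; rewrite B_Phi.
  move=> /(congr1 trmx); rewrite trmxK trmx_mul => dN.
  (* Independence: if the combination is [T u], then [L u = 0], so its second component is some
     [M *m d]. Transposed, it lies both in the row space of [M^T] and in the chosen complement,
     hence is zero. *)
  have : (\row_i c i *m N <= M^T :&: (M^T)^C)%MS.
    rewrite sub_capmx -{1}dN submxMl.
    by rewrite (submx_trans (submxMl _ _))// eq_row_base.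
  rewrite capmx_compl submx0 => /eqP.
  have /row_freeP[N' NN'] : row_free N by exact: row_base_free.
  move=> /(congr1 (mulmx^~ N')); rewrite -mulmxA NN' mulmx1 mul0mx => c0 i.
  by have := congr1 (fun w : 'rV_ _ => w 0 i) c0; rewrite !mxE.
rewrite -[x]coker_piK; case: (repr x) => f v.
have [u Lu] := L_surj f.
have : ((v - B u)^T <= M^T + N)%MS.
  apply: (submx_trans _ (addsmxS (submx_refl _) (_ : (M^T^C <= N)%MS))).
    by rewrite submx_full// addsmx_compl_full.
  by rewrite eq_row_base.
move=> /sub_addsmxP[[d w] /= vBu].
exists (fun i => w 0 i); rewrite eE; apply/coker_piP/asboolP.
(* [u] accounts for [f], and [Phi d^T], which [L] does not see, accounts for the part of [v - B u]
   in the column space of [M]. What remains is [(0, (w *m N)^T)]. *)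
exists (u + Phi d^T); rewrite TE !linearD L_Phi B_Phi addr0 Lu.
apply: injective_projections => /=; first by rewrite subr0.
have -> : \row_i w 0 i = w by apply/rowP => i; rewrite mxE.
apply: trmx_inj; rewrite !linearD linearN /= trmxK trmx_mul trmxK.
move: vBu; rewrite linearD linearN /= => vBu.
by apply/eqP; rewrite eq_sym subr_eq -addrA -vBu addrC subrK.
Qed.
End bordered_operator.

(** * Limits of real parts, imaginary parts and conjugates *)

Lemma cvg_near_eq (T : Type) (U : topologicalType) (F : set_system T)
    {FF : Filter F} (f g : T -> U) (l : U) :
  g @ F --> l -> {near F, f =1 g} -> f @ F --> l.
Proof.
by move=> gl fg; apply: cvg_trans gl; apply: near_eq_cvg; apply: filterS fg.
Qed.

Section complex_limits.
Variables (R : realType) (T : Type) (F : set_system T).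
Context {FF : Filter F}.
Implicit Types (f : T -> R[i]) (l : R[i]).

Lemma normr_Re_le (z : R[i]) : `|complex.Re z| <= Normc.normc z.
Proof. by rewrite -lecR -normCE normc_ge_Re. Qed.

Lemma cvg_Re f l : f @ F --> l -> complex.Re (f t) @[t --> F] --> complex.Re l.
Proof.
move=> /cvgrPdist_lt fl; apply/cvgrPdist_lt => e e0.
have : \forall t \near F, `|l - f t| < e%:C by apply: fl; rewrite ltcR.
apply: filterS => t; rewrite normCE ltcR; apply: le_lt_trans.
by rewrite -raddfB normr_Re_le.
Qed.

Lemma cvg_conjc f l : f @ F --> l -> (f t)^*%C @[t --> F] --> l^*%C.
Proof.
move=> /cvgrPdist_lt fl; apply/cvgrPdist_lt => e /fl.
by apply: filterS => t; rewrite -raddfB /= normcJ.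
Qed.

Lemma cvg_Im f l : f @ F --> l -> complex.Im (f t) @[t --> F] --> complex.Im l.
Proof.
move=> fl; have fli : f t * 'i%C @[t --> F] --> l * 'i%C.
  exact: (cvgM fl (cvg_cst 'i%C)).
have H := cvgN (cvg_Re fli).
have ImE (z : R[i]) : complex.Im z = - complex.Re (z * 'i%C) by rewrite ReiNIm opprK.
by rewrite (funext (fun t => ImE (f t))) ImE; exact: H.
Qed.

End complex_limits.

(** * Extension of functions from the segment to the real line *)

Section clamp.
Variables (R : realType) (a b : R) (ab : a < b).
Implicit Types (f g : seg ab -> R[i]) (t : seg ab) (x : R).

Fact clamp_subproof x : a <= Num.max a (Num.min x b) <= b.
Proof. by rewrite le_max lexx ge_max (ltW ab) ge_min lexx orbT. Qed.

(** The nearest-point retraction of the line onto [[a, b]]. Composing with it gives functions on all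
    of [R], to which integration and the monotonicity criteria for real functions apply. *)
Definition clamp x : seg ab := mkseg ab (clamp_subproof x).

Lemma segval_clamp x : a <= x <= b -> clamp x = x :> R.
Proof. by move=> /andP[ax xb]; rewrite segvalK min_l// max_r. Qed.

Lemma clampK t : clamp t = t.
Proof. by apply: seg_inj; rewrite segval_clamp// segP. Qed.

Lemma clamp_lipschitz x y : `|(clamp x : R) - (clamp y : R)| <= `|x - y|.
Proof.
have maxl u v : `|Num.max a u - Num.max a v| <= `|u - v|.
  by case: (leP a u) => ?; case: (leP a v) => ?; rewrite ?subrr ?normr_ge0//;
    apply/ler_normlP; split; rewrite ?ler_normr; lra.
have minr u v : `|Num.min u b - Num.min v b| <= `|u - v|.
  by case: (leP u b) => ?; case: (leP v b) => ?; rewrite ?subrr ?normr_ge0//;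
    apply/ler_normlP; split; rewrite ?ler_normr; lra.
exact: le_trans (maxl _ _) (minr _ _).
Qed.

Lemma clamp_continuous : continuous clamp.
Proof.
move=> x A /nbhs_ballP[e /= e0 eA]; apply/nbhs_ballP; exists e => // y xy.
by apply: eA; rewrite seg_ballE (le_lt_trans (clamp_lipschitz _ _)).
Qed.

(** Near an interior point [clamp] is the identity, so it avoids the value [clamp x] when [h] is
    nonzero. This is what transfers limits of [dquot], which are taken over punctured
    neighbourhoods. *)
Lemma clamp_dnbhs x : a < x < b -> clamp (h + x) @[h --> 0^'] --> (clamp x)^'.
Proof.
move=> /andP[ax xb] A /nbhs_ballP[e /= e0 eA].
pose d := Num.min e (Num.min (x - a) (b - x)).
have d0 : 0 < d by rewrite !lt_min e0 !subr_gt0 ax xb.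
apply/nbhs_ballP; exists d => // h; rewrite /ball /= sub0r normrN => hd h0.
move: hd; rewrite /d !lt_min => /and3P[he hxa hbx].
have xh : a <= h + x <= b by move: hxa hbx; rewrite !ltr_norml; lra.
have xx : a <= x <= b by lra.
apply: eA.
  by rewrite seg_ballE !segval_clamp// opprD addrCA subrr addr0 normrN.
apply/eqP => /(congr1 (@segval _ _ _ _)); rewrite !segval_clamp// => /eqP.
by rewrite -subr_eq0 addrK (negPf h0).
Qed.

(** Interior points only: at [a] and [b] the clamped function is constant on the outer side and may
    have a corner. *)
Lemma is_derive_Re_clamp f g x : has_deriv f g -> a < x < b ->
  is_derive x 1 (fun y => complex.Re (f (clamp y))) (complex.Re (g (clamp x))).
Proof.
move=> fg xab.
have H : h^-1 *: (((fun y => complex.Re (f (clamp y))) \o shift x) (h *: 1)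
    - complex.Re (f (clamp x))) @[h --> 0^'] --> complex.Re (g (clamp x)).
  apply: (cvg_near_eq (cvg_Re (cvg_comp _ _ (clamp_dnbhs xab) (fg (clamp x))))).
  near=> h.
  have /andP[h1 h2] : a < h + x < b.
    near: h; apply: cvg_within; move/andP: (xab) => [ax xb].
    apply/nbhs_ballP; exists (Num.min (x - a) (b - x)).
      by rewrite /= lt_min !subr_gt0 ax xb.
    move=> h; rewrite /ball /= sub0r normrN lt_min !ltr_norml; lra.
  have xh : a <= h + x <= b by lra.
  have xx : a <= x <= b by lra.
  rewrite /= /dquot !segval_clamp// addrK [h%:A]mulr1 -fmorphV.
  rewrite [LHS](_ : _ = h^-1 * complex.Re (f (clamp (h + x)) - f (clamp x))).
    by case: (f _ - f _) => u v; rewrite /= mulr0 subr0 mulrC.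
  by rewrite [in RHS]raddfB.
by apply: DeriveDef; [apply/cvg_ex; exists (complex.Re (g (clamp x)))|exact/cvg_lim].
Unshelve. all: by end_near. Qed.

Lemma continuous_Re_clamp f : continuous f ->
  continuous (fun y => complex.Re (f (clamp y))).
Proof.
move=> cf x.
exact: (cvg_Re (cvg_comp _ _ (@clamp_continuous x) (cf (clamp x)))).
Qed.

Lemma continuous_Im_clamp f : continuous f ->
  continuous (fun y => complex.Im (f (clamp y))).
Proof.
move=> cf x.
exact: (cvg_Im (cvg_comp _ _ (@clamp_continuous x) (cf (clamp x)))).
Qed.

End clamp.

(** * Calculus on the segment: derivation rules, primitives, Gronwall's inequality, determinants *)

Section calculus.
Variables (R : realType) (a b : R) (ab : a < b).
Implicit Types (f g : seg ab -> R[i]) (t : seg ab).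

Lemma Cn_has_deriv n f : Cn n.+1 f -> has_deriv f (deriv f).
Proof. by case. Qed.

Lemma has_deriv_Cn n f g : has_deriv f g -> Cn n g -> Cn n.+1 f.
Proof. by move=> fg cg; apply/CnSP; exists g. Qed.

Lemma has_deriv_sum (I : Type) (r : seq I) (F G : I -> seg ab -> R[i]) :
  (forall i, has_deriv (F i) (G i)) ->
  has_deriv (\sum_(i <- r) F i) (\sum_(i <- r) G i).
Proof.
move=> FG; elim/big_ind2: _ => [|f1 g1 f2 g2 h1 h2|//].
  exact: has_deriv_cst.
by rewrite -[f1]scale1r -[g1]scale1r; exact: has_deriv_lin.
Qed.

Lemma has_deriv_conjc f g : has_deriv f g ->
  has_deriv (fun t => (f t)^*%C) (fun t => (g t)^*%C).
Proof.
move=> fg t; apply: (cvg_near_eq (cvg_conjc (fg t))); near=> s.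
by rewrite /dquot rmorphM fmorphV [X in _ = X / _]rmorphB [X in _ = _ / X]conjc_real.
Unshelve. all: by end_near. Qed.

Lemma has_derivV f g : has_deriv f g -> (forall t, f t != 0) ->
  has_deriv (fun t => (f t)^-1) (fun t => - g t * ((f t)^-1 * (f t)^-1)).
Proof.
move=> fg f0 t.
have cf : f s @[s --> t^'] --> f t.
  by apply/continuous_withinNx; exact: has_deriv_continuous fg _.
have H : - dquot f t s * ((f s)^-1 * (f t)^-1) @[s --> t^']
    --> - g t * ((f t)^-1 * (f t)^-1).
  exact: (cvgM (cvgN (fg t)) (cvgM (cvgV (f0 t) cf) (cvg_cst (f t)^-1))).
apply: (cvg_near_eq H); near=> s.
have st : s != t by near: s; exact: nbhs_dnbhs_neq.
rewrite /dquot; field.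
rewrite !f0 -rmorphB -(rmorph0 (@real_complex R)) (inj_eq (@complexI R)) subr_eq0.
by apply: contra st => /eqP/seg_inj ->.
Unshelve. all: by end_near. Qed.

Lemma CnV n f : Cn n f -> (forall t, f t != 0) -> Cn n (fun t => (f t)^-1).
Proof.
move=> + f0; elim: n => [cf t|n IH cf]; first exact: (cvgV (f0 t) (cf t)).
apply: (has_deriv_Cn (has_derivV (Cn_has_deriv cf) f0)).
have cV : Cn n (fun t => (f t)^-1) by apply/IH/CnS.
apply: (@CnM _ _ _ _ n (- deriv f) ((fun t => (f t)^-1) * (fun t => (f t)^-1))).
  by rewrite -scaleN1r; apply/CnZ/Cn_deriv.
exact: CnM.
Qed.

Lemma Cn_prod n (I : Type) (r : seq I) (F : I -> seg ab -> R[i]) :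
  (forall i, Cn n (F i)) -> Cn n (\prod_(i <- r) F i).
Proof.
move=> cF; elim/big_ind: _ => //; [exact: Cn_cst|by move=> *; exact: CnM].
Qed.

(** A two-sided derivative on the line restricts to the segment, end points included, through the
    substitution [h = s - t]. *)
Lemma has_deriv_realC (F f : R -> R) :
  (forall x, a <= x <= b -> is_derive x 1 F (f x)) ->
  has_deriv (fun t : seg ab => (F (segval t))%:C) (fun t => (f (segval t))%:C).
Proof.
move=> Ff t; have [dF DF] := Ff _ (segP t).
have st0 : segval s - segval t @[s --> t^'] --> 0^'.
  move=> A /nbhs_ballP[e /= e0 eA]; apply/nbhs_ballP; exists e => // s.
  rewrite seg_ballE => st /= sNt; apply: eA.
    by rewrite /ball /= sub0r opprB.
  by rewrite subr_eq0; apply: contra sNt => /eqP/seg_inj ->.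
have H : h^-1 *: ((F \o shift (segval t)) (h *: 1) - F (segval t)) @[h --> 0^']
    --> f (segval t) by rewrite -DF; exact: dF.
apply: (cvg_near_eq (cvg_realC (cvg_comp _ _ st0 H))); near=> s.
rewrite /dquot -rmorphB -fmorphV -rmorphM; congr (_%:C).
by rewrite /= [(_ - _)%:A]mulr1 subrK [RHS]mulrC.
Unshelve. all: by end_near. Qed.

Lemma continuous_is_derive (f : R -> R) : continuous f ->
  exists F : R -> R, forall x, a <= x <= b -> is_derive x 1 F (f x).
Proof.
(* Integrating from [a - 1], and below up to [b + 1], makes every point of [[a, b]] interior, so
   that the fundamental theorem of calculus gives a two-sided derivative at [a] and [b] too. *)
move=> cf; exists (fun x => \int[lebesgue_measure]_(t in `[(a - 1)%R, x]) f t)%R.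
move=> x /andP[ax xb].
have [||||dF F'] := @continuous_FTC1_closed R f (a - 1) x (b + 1).
- lra.
- apply: continuous_compact_integrable; first exact: segment_compact.
  exact: continuous_subspaceT.
- lra.
- exact: cf.
exact: DeriveDef dF (etrans (esym (derive1E _ _)) F').
Qed.

(** The clamped real and imaginary parts are continuous on the whole line; their primitives are
    recombined with the factor ['i]. *)
Lemma continuous_primitive f : continuous f -> exists F, has_deriv F f.
Proof.
move=> cf.
have [F HF] := continuous_is_derive (continuous_Re_clamp cf).
have [G HG] := continuous_is_derive (continuous_Im_clamp cf).
have := has_deriv_lin (c := 'i%C) (has_deriv_realC HG) (has_deriv_realC HF).
set H := _ + _; set h := _ + _ => Hh; exists H.
suff -> : f = h by [].
by apply/funext => t; rewrite /h [LHS]complexE !fctE clampK addrC.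
Qed.

(** With [F] the clamped real part of [f], the bound makes [F x * expR (- K * x)] nonincreasing and
    [F x * expR (K * x)] nondecreasing on [[a, b]]. As [F] is nonnegative, its zero at [t0] spreads
    to the right by the former and to the left by the latter. *)
Lemma gronwall_eq0 f g (K : R) t0 : has_deriv f g ->
  (forall t, 0 <= complex.Re (f t)) ->
  (forall t, `|complex.Re (g t)| <= K * complex.Re (f t)) ->
  complex.Re (f t0) = 0 -> forall t, complex.Re (f t) = 0.
Proof.
move=> fg f0 gK ft0 t; apply/eqP; rewrite eq_le f0 andbT.
pose F x := complex.Re (f (clamp ab x)).
pose G x := complex.Re (g (clamp ab x)).
have cF : continuous F by exact/continuous_Re_clamp/(has_deriv_continuous fg).
have dE c x : a < x < b ->
    is_derive x 1 (fun y => F y * expR (c * y)) ((G x + c * F x) * expR (c * x)).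
  move=> xab; have dF := is_derive_Re_clamp fg xab.
  apply: is_derive_eq; rewrite /G /F /GRing.scale /=; ring.
have cE c : {within `[a, b], continuous (fun y => F y * expR (c * y))}.
  apply: continuous_subspaceT => x.
  have cx : c * y @[y --> x] --> c * x by exact: (cvgM (cvg_cst c) cvg_id).
  exact: (cvgM (cF x) (cvg_comp _ _ cx (@continuous_expR R _))).
have FE (s : seg ab) : F (segval s) = complex.Re (f s) by rewrite /F clampK.
have [/andP[at0 t0b] /andP[at_ tb]] := (segP t0, segP t).
have GF x : - (K * F x) <= G x <= K * F x by rewrite -ler_norml; exact: gK.
have [tt0|/ltW tt0] := leP (segval t0) (segval t).
- have := @ler0_derive1_nincr R (fun y => F y * expR (- K * y)) a b.
  move=> /(_ _ _ (cE _) (segval t0) (segval t) at0 tt0 tb); rewrite !FE ft0 mul0r.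
  rewrite pmulr_lle0 ?expR_gt0//; apply.
    by move=> x; rewrite in_itv /= => xab; have [] := dE (- K) x xab.
  move=> x; rewrite in_itv /= derive1E => xab; have [_ ->] := dE (- K) x xab.
  rewrite pmulr_lle0 ?expR_gt0//; have := GF x; lra.
- have := @ger0_derive1_ndecr R (fun y => F y * expR (K * y)) a b.
  move=> /(_ _ _ (cE _) (segval t) (segval t0) at_ tt0 t0b); rewrite !FE ft0 mul0r.
  rewrite pmulr_lle0 ?expR_gt0//; apply.
    by move=> x; rewrite in_itv /= => xab; have [] := dE K x xab.
  move=> x; rewrite in_itv /= derive1E => xab; have [_ ->] := dE K x xab.
  rewrite pmulr_lge0 ?expR_gt0//; have := GF x; lra.
Qed.

(** The end points are limits of interior points. This carries the equation in [matrix_cauchy],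
    imposed on the open interval only, over to the closed one. *)
Lemma continuous_eq0_interior (f : seg ab -> R[i]) : continuous f ->
  (forall t, a < (t : R) < b -> f t = 0) -> forall t, f t = 0.
Proof.
move=> cf f0 t; have [/f0//|tab] := boolP (a < segval t < b).
have ft : f s @[s --> t^'] --> f t by apply/continuous_withinNx; exact: cf.
have f_0 : f s @[s --> t^'] --> (0 : R[i]).
  apply: (cvg_near_eq (cvg_cst 0)).
  (* The open ball of radius [b - a] around one end point misses the other, so all its points except
     the centre are interior. *)
  apply/nbhs_ballP; exists (b - a); rewrite /= ?subr_gt0// => s.
  rewrite seg_ballE => st sNt; have [|sab] := boolP (a < segval s < b); first exact: f0.
  have {}sNt : segval s != segval t by apply: contra sNt => /eqP/seg_inj ->.
  have [/andP[? ?] /andP[? ?]] := (segP s, segP t); move: st sab tab sNt.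
  rewrite ltr_norml !negb_and -!leNgt neq_lt => /andP[? ?].
  by move=> /orP[?|?] /orP[?|?] /orP[?|?]; exfalso; lra.
exact: (cvg_unique _ ft f_0).
Qed.

(** By the Leibniz formula a determinant is a finite sum of signed products of entries. *)
Lemma Cn_det k p (F : seg ab -> 'M[R[i]]_p) :
  (forall i j, Cn k (entry F i j)) -> Cn k (fun t => \det (F t)).
Proof.
move=> cF; rewrite [X in Cn k X](_ : _ = \sum_(s <- enum {perm 'I_p})
  (-1) ^+ s *: \prod_(i <- enum 'I_p) entry F i (s i)).
  by apply: Cn_sum => s; apply/CnZ/Cn_prod.
apply/funext => t; rewrite fct_sumE big_enum; apply: eq_bigr => s _.
by rewrite fctE fct_prodE big_enum.
Qed.

End calculus.

(** * Uniqueness for the homogeneous system with a prescribed value at any one point *)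

Section cauchy_uniqueness.
Variables (R : realType) (a b : R) (ab : a < b) (n m : nat).
Variables (A : Cspace ab n m m).
Implicit Types (y : Cspace ab n.+1 m 1) (t : seg ab).

Lemma normc_sum (I : Type) (r : seq I) (F : I -> R[i]) :
  Normc.normc (\sum_(i <- r) F i) <= \sum_(i <- r) Normc.normc (F i).
Proof.
elim/big_ind2: _ => [|x1 x2 y1 y2 h1 h2|//]; first by rewrite Normc.normc0.
by apply: le_trans (normcD _ _) _; exact: lerD.
Qed.

Lemma entry_opL y t i : opL A y t i 0 =
  deriv (entry y i 0) t + \sum_k A t i k * y t k 0.
Proof. by rewrite /= /opL_fun !mxE. Qed.

Lemma Re_mulcJ (z : R[i]) : complex.Re (z * z^*%C) = Normc.normc z ^+ 2.
Proof. by rewrite -sqr_normc normCE -rmorphXn. Qed.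

Lemma normc_conjc (z : R[i]) : Normc.normc z^*%C = Normc.normc z.
Proof. by apply: complexI; rewrite -!normCE normcJ. Qed.

(* Gronwall's inequality for the energy [\sum_i |y_i|^2]. *)
Lemma opL_eq0 y t0 : opL A y = 0 -> y t0 = 0 -> y = 0.
Proof.
move=> Ly0 yt0.
(* A crude bound for every [|A t i k|], uniform in [t], [i] and [k]. *)
pose K := \sum_i \sum_k supnorm (entry A i k).
have A0 i k : 0 <= supnorm (entry A i k).
  exact/supnorm_ge0/Cn_continuous/Cspace_entry.
have K0 : 0 <= K by rewrite !sumr_ge0// => i _; rewrite sumr_ge0.
have K_ge t i k : Normc.normc (A t i k) <= K.
  apply: (@le_trans _ _ (supnorm (entry A i k))).
    exact/(@supnorm_ge _ _ _ _ (entry A i k))/Cn_continuous/Cspace_entry.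
  rewrite /K (bigD1 i)//= (bigD1 k)//= -addrA lerDl addr_ge0// sumr_ge0// => j _.
  by rewrite sumr_ge0.
pose u t i := Normc.normc (y t i 0).
have u0 t i : 0 <= u t i by exact: normc_ge0.
have du t i : Normc.normc (deriv (entry y i 0) t) <= K * \sum_k u t k.
  have := congr1 (fun z : Cspace ab n m 1 => z t i 0) Ly0.
  rewrite entry_opL mxE => /eqP; rewrite addr_eq0 => /eqP ->.
  have -> z : Normc.normc (- z) = Normc.normc z :> R.
    by apply: complexI; rewrite -!normCE normrN.
  apply: le_trans (normc_sum _ _) _; rewrite mulr_sumr; apply: ler_sum => k _.
  by rewrite Normc.normcM ler_wpM2r ?normc_ge0 ?K_ge.
(* Each [|y_i|^2] is written as [y_i] times its conjugate, so that the product rule gives the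
   derivative [E']. *)
pose E := \sum_(i <- enum 'I_m) entry y i 0 * (fun t => (entry y i 0 t)^*%C).
pose E' := \sum_(i <- enum 'I_m)
  (deriv (entry y i 0) * (fun t => (entry y i 0 t)^*%C)
   + entry y i 0 * (fun t => (deriv (entry y i 0) t)^*%C)).
have EE' : has_deriv E E'.
  apply: has_deriv_sum => i.
  have dy := Cn_has_deriv (Cspace_entry y i 0).
  exact: (has_derivM dy (has_deriv_conjc dy)).
have ReE t : complex.Re (E t) = \sum_i u t i ^+ 2.
  by rewrite /E fct_sumE raddf_sum big_enum; apply: eq_bigr => i _; rewrite -Re_mulcJ.
(* With [u_i = |y_i|], [|E'|] is at most the sum over [i] and [k] of [2 K u_i u_k], hence of
   [K (u_i^2 + u_k^2)]. Each square then occurs [2 m] times. *)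
have ReE' t : `|complex.Re (E' t)| <= (K * (2 * m%:R)) * complex.Re (E t).
  apply: le_trans (normr_Re_le _) _; rewrite /E' fct_sumE.
  apply: le_trans (normc_sum _ _) _; rewrite ReE big_enum /=.
  apply: (@le_trans _ _ (\sum_i \sum_k K * (u t i ^+ 2 + u t k ^+ 2))).
    apply: ler_sum => i _; apply: le_trans (normcD _ _) _.
    rewrite !Normc.normcM !normc_conjc -/(u t i).
    apply: (@le_trans _ _ (2 * (u t i * (K * \sum_k u t k)))).
      rewrite [X in X + _]mulrC -mulr2n -[_ *+ 2]mulr_natl ler_wpM2l//.
      exact: ler_wpM2l (u0 t i) _ _ (du t i).
    rewrite !mulr_sumr; apply: ler_sum => k _.
    rewrite -subr_ge0 [leRHS](_ : _ = K * (u t i - u t k) ^+ 2); last by ring.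
    by rewrite mulr_ge0// sqr_ge0.
  under [leLHS]eq_bigr do rewrite -mulr_sumr big_split /= sumr_const card_ord.
  rewrite -mulr_sumr big_split /= sumr_const card_ord sumrMnl.
  by rewrite -mulr2n -mulrnA -[_ *+ (m * 2)]mulr_natl natrM mulrA [_ * 2]mulrC.
have E0 t : 0 <= complex.Re (E t).
  by rewrite ReE; apply: sumr_ge0 => i _; exact: sqr_ge0.
have Et0 : complex.Re (E t0) = 0.
  by rewrite ReE big1// => i _; rewrite /u yt0 mxE Normc.normc0 expr0n.
apply: CfunP => t i j; rewrite (ord1 j) mxE; apply: Normc.eq0_normc.
have /eqP := gronwall_eq0 EE' E0 ReE' Et0 t.
rewrite ReE psumr_eq0; last by move=> k _; exact: sqr_ge0.
by move=> /allP/(_ i); rewrite mem_index_enum => /(_ isT); rewrite /= sqrf_eq0 => /eqP.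
Qed.
End cauchy_uniqueness.

(** * The fundamental matrix [Y]: parametrisation of the kernel of [opL], invertibility,
    inhomogeneous equation *)

Section fundamental_matrix.
Variables (R : realType) (a b : R) (ab : a < b) (n m : nat).
Variables (A : Cspace ab n m m) (Y : Cspace ab n.+1 m m).
Hypothesis Y_sol : matrix_cauchy A Y.
Implicit Types (t : seg ab) (c : 'cV[R[i]]_m).

Lemma matrix_cauchy_closed t i j :
  deriv (entry Y i j) t + \sum_k A t i k * Y t k j = 0.
Proof.
move: t; apply: continuous_eq0_interior => [|t tab].
  apply: (@Cn_continuous _ _ _ _ n).
  apply: (@CnD _ _ _ _ n (deriv (entry Y i j))
    (fun t => \sum_k A t i k * Y t k j)).
    exact/Cn_deriv/Cspace_entry.
  rewrite [X in Cn n X](_ : _ =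
    \sum_(k <- enum 'I_m) entry A i k * entry Y k j).
    apply: Cn_sum => k; apply: CnM; first exact: Cspace_entry.
    exact/CnS/Cspace_entry.
  by apply/funext => t; rewrite fct_sumE big_enum.
by have := congr1 (fun M : 'M[R[i]]_m => M i j) (proj1 Y_sol t tab); rewrite !mxE.
Qed.

(** This is the function [Y t *m c]. As a combination of columns it belongs to [Cspace] by
    construction, and [opL] and [B] pass through the sum by linearity. *)
Definition solution_of c : Cspace ab n.+1 m 1 := \sum_j c j 0 *: Ccol Y j.

Lemma solution_ofE c t : solution_of c t = Y t *m c.
Proof.
rewrite /solution_of /Cfun raddf_sum fct_sumE; apply/colP => i.
by rewrite summxE mxE; apply: eq_bigr => j _; rewrite !mxE mulrC.
Qed.

Fact solution_of_linear : linear solution_of.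
Proof.
move=> k c d; apply: CfunP => t i j.
by rewrite CfunD CfunZ !fctE !solution_ofE mulmxDr -scalemxAr.
Qed.
HB.instance Definition _ :=
  GRing.isLinear.Build R[i] _ _ _ solution_of solution_of_linear.

Lemma opL_solution_of c : opL A (solution_of c) = 0.
Proof.
rewrite linear_sum big1// => j _; rewrite linearZ /=.
suff -> : opL A (Ccol Y j) = 0 by rewrite scaler0.
apply: CfunP => t i k; rewrite (ord1 k) entry_opL [RHS]mxE.
have -> : entry (Ccol Y j) i 0 = entry Y i j.
  by apply/funext => s; rewrite /entry mxE.
rewrite -[RHS](matrix_cauchy_closed t i j); congr (_ + _).
by apply: eq_bigr => k' _; rewrite mxE.
Qed.

Let ta : seg ab := clamp ab a.
Let Y_ta : Y ta = 1%:M.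
Proof. by apply: (proj2 Y_sol); rewrite segval_clamp// lexx ltW. Qed.

Lemma solution_of_inj c : solution_of c = 0 -> c = 0.
Proof.
move=> /(congr1 (fun y : Cspace _ _ _ _ => y ta)).
by rewrite solution_ofE Y_ta mul1mx.
Qed.

Lemma ker_opL y : opL A y = 0 -> exists c, y = solution_of c.
Proof.
(* The parameter is the initial value of [y]: since [Y] is the identity at [a], the two solutions
   agree there and [opL_eq0] applies to their difference. *)
move=> Ly; exists (y ta); apply/eqP; rewrite -subr_eq0; apply/eqP.
apply: (@opL_eq0 _ _ _ _ _ _ A _ ta).
  by rewrite linearB /= Ly opL_solution_of subrr.
by rewrite /Cfun raddfB /= !fctE [X in _ - X]solution_ofE Y_ta mul1mx subrr.
Qed.

(** A null vector of [Y t] yields a solution vanishing at [t], hence everywhere, against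
    [solution_of_inj]. Uniqueness is used here from an arbitrary point, not only from [a]. *)
Lemma det_fundamental_neq0 t : \det (Y t) != 0.
Proof.
rewrite -det_tr; apply/negP => /det0P[v v0 vY]; case/eqP: v0.
apply: trmx_inj; rewrite trmx0; apply: solution_of_inj.
apply: (opL_eq0 (opL_solution_of _) (t0 := t)).
by rewrite solution_ofE; apply: trmx_inj; rewrite trmx_mul trmxK vY trmx0.
Qed.

(** Cramer's rule: the inverse is the adjugate divided by a determinant that never vanishes, and the
    cofactors are determinants of entries of [Y]. *)
Lemma Cn_invmx i j : Cn n.+1 (fun t => invmx (Y t) i j).
Proof.
rewrite [X in Cn _ X](_ : _ =
  (fun t => (\det (Y t))^-1)
    * ((-1) ^+ (j + i) *: (fun t => \det (row' j (col' i (Y t)))))).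
  apply: CnM.
    by apply: CnV det_fundamental_neq0; apply: Cn_det; exact: Cspace_entry.
  apply/CnZ/Cn_det => i' j'.
  rewrite [X in Cn _ X](_ : _ = entry Y (lift j i') (lift i j')).
    exact: Cspace_entry.
  by apply/funext => t; rewrite /entry !mxE.
apply/funext => t; rewrite /invmx unitmxE unitfE det_fundamental_neq0 !mxE.
by rewrite /cofactor.
Qed.

(* Variation of constants: [y = Y * int (Y^-1 f)]. *)
Lemma opL_surj (f : Cspace ab n m 1) : exists y, opL A y = f.
Proof.
pose h i := \sum_(k <- enum 'I_m) (fun t => invmx (Y t) i k) * entry f k 0.
have ch i : Cn n (h i).
  by apply: Cn_sum => k; apply: CnM; [exact/CnS/Cn_invmx|exact: Cspace_entry].
have /choice[H Hh] i : exists F, has_deriv F (h i).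
  exact/continuous_primitive/Cn_continuous/ch.
have cH i : Cn n.+1 (H i) by exact: has_deriv_Cn (Hh i) (ch i).
pose u t : 'cV[R[i]]_m := Y t *m \col_i H i t.
have uE i j : entry u i j = \sum_(k <- enum 'I_m) entry Y i k * H k.
  apply/funext => t; rewrite /entry !mxE fct_sumE big_enum.
  by apply: eq_bigr => k _; rewrite !mxE.
have cu : u \in @Cn_pred R a b ab n.+1 m 1.
  apply/asboolP => i j; rewrite uE; apply: Cn_sum => k.
  by apply: CnM; [exact: Cspace_entry|exact: cH].
exists (exist _ u cu); apply: CfunP => t i j; rewrite (ord1 j) entry_opL.
rewrite [entry _ i 0]uE.
have -> : deriv (\sum_(k <- enum 'I_m) entry Y i k * H k)
    = \sum_(k <- enum 'I_m) (deriv (entry Y i k) * H k + entry Y i k * h k).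
  apply/has_derivE/has_deriv_sum => k; apply: has_derivM (Hh k).
  exact: Cn_has_deriv (Cspace_entry Y i k).
have Yh : \sum_k Y t i k * h k t = f t i 0.
  have <- : (Y t *m (invmx (Y t) *m f t)) i 0 = f t i 0.
    by rewrite mulKVmx// unitmxE unitfE det_fundamental_neq0.
  rewrite mxE; apply: eq_bigr => k _; rewrite /h fct_sumE big_enum mxE.
  by congr (_ * _).
rewrite fct_sumE big_enum /= big_split /= -/(entry _ _ _) [X in _ + X + _]Yh.
rewrite addrAC -[RHS]add0r; congr (_ + _).
(* The terms [Y h] have already produced [f]. Those in [H] regroup as [(Y' + A Y) H], which vanishes
   because [Y] solves the homogeneous equation. *)
transitivity (\sum_k (deriv (entry Y i k) t + \sum_j A t i j * Y t j k) * H k t).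
  rewrite (eq_bigr _ (fun k _ => mulrDl _ _ _)) big_split /=; congr (_ + _).
  under [RHS]eq_bigr do rewrite mulr_suml.
  rewrite exchange_big /=; apply: eq_bigr => k _; rewrite /u mxE mulr_sumr.
  by apply: eq_bigr => k' _; rewrite mxE mulrA.
by rewrite big1// => k _; rewrite matrix_cauchy_closed mul0r.
Qed.

Variables (l : nat) (B : {linear Cspace ab n.+1 m 1 -> 'cV[R[i]]_l}).

(** The columns of [charmx B Y] are the values of [B] on the columns of [Y], so this is linearity of
    [B]. *)
Lemma bc_solution_of c : B (solution_of c) = charmx B Y *m c.
Proof.
rewrite linear_sum; apply/colP => i; rewrite summxE mxE; apply: eq_bigr => j _.
by rewrite linearZ !mxE mulrC.
Qed.

End fundamental_matrix.

Unset Implicit Arguments.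

(* The order of differentiability, a positive integer, is written n.+1. *)
Theorem mainTheorem2 (R : realType) (a b : R) (ab : a < b) (m l n : nat)
  (m_gt0 : (0 < m)%N) (l_gt0 : (0 < l)%N)
  (A : Cspace ab n m m)
  (B : {linear Cspace ab n.+1 m 1 -> 'cV[R[i]]_l}) (B_cont : continuous B)
  (Y : Cspace ab n.+1 m m) (Y_sol : matrix_cauchy A Y) :
  has_dim (ker (opLB A B)) (m - \rank (charmx B Y))%N /\
  has_dim (coker (opLB A B)) (l - \rank (charmx B Y))%N.
Proof.
have TE u : opLB A B u = (opL A u, B u) by [].
have inj := solution_of_inj Y_sol.
have LS := opL_solution_of Y_sol.
have kerL := ker_opL Y_sol.
have surj := opL_surj Y_sol.
have BS := bc_solution_of Y B.
split.
  exact: (has_dim_ker_bordered TE inj LS kerL BS).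
exact: (has_dim_coker_bordered TE LS kerL BS surj).
Qed.
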